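(* Let $C$ be a nonempty, closed and geodesically convex subset of a Hadamard manifold $\mathbb{M}$, let $\beta>0$, and let $F\colon C\times C\to\mathbb{R}$ be a $\beta$-strongly pseudomonotone bifunction such that $F(x,x)=0$ for all $x\in C$ and Assumptions (A2) and (A3) listed in the context hold. Let $x^*\in\mathrm{EP}(F,C)$ be the unique solution of the equilibrium problem. Let $\lambda\in(0,\infty)$ and let $\{\lambda_n\}_{n\ge 0}$ be a sequence of real numbers with $\lambda_n\ge\lambda$ for all $n$. Let $x_0\in C$ and let $\{x_n\}_{n\ge0}$, $\{y_n\}_{n\ge0}$ be sequences in $C$ such that for every $n\ge0$: (1) $y_n\in C$ is a point satisfying $\lambda_nF(y_n,y)+d(y_n,x_n)\,b_{\gamma_{y_n,x_n}}(y)\ge 0$ for all $y\in C$; (2) $x_{n+1}=\operatorname{argmin}_{y\in C}\{F(y_n,y)+\frac{1}{2\lambda_n}d^2(x_n,y)\}$. Then $$d(x_n,x^* )\le\left(1+\frac{1}{\beta\lambda_n}\right)d(y_n,x_n)\quad\text{for all } n\ge 0.$$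
   Context: A Hadamard manifold $\mathbb{M}$ is a complete simply connected (finite-dimensional) Riemannian manifold of nonpositive sectional curvature; $d$ is its Riemannian distance and $\exp_x\colon T_x\mathbb{M}\to\mathbb{M}$ its exponential map. A subset $C\subset\mathbb{M}$ is geodesically convex if the geodesic segment joining any two of its points lies in $C$; a real function on $C$ is geodesically convex if its restriction to each geodesic segment in $C$ is convex. Equilibrium problem: $\mathrm{EP}(F,C)=\{x^*\in C: F(x^*,y)\ge0\text{ for all }y\in C\}$. $F$ is $\beta$-strongly pseudomonotone if for all $x,y\in C$, $F(x,y)\ge0$ implies $F(y,x)\le-\beta d^2(x,y)$. Busemann function: for $z\neq x$ in $\mathbb{M}$, let $\gamma_{z,x}\colon[0,\infty)\to\mathbb{M}$ be the unit-speed geodesic ray starting at $z$ and passing through $x$, and $b_{\gamma_{z,x}}(y)=\lim_{t\to+\infty}[d(y,\gamma_{z,x}(t))-t]$. When $x=z$, the product $d(z,x)b_{\gamma_{z,x}}(y)$ is understood as $0$. Subdifferential: for $f\colon C\to\mathbb{R}$ and $x\in C$, $\partial f(x)=\{v\in T_x\mathbb{M}:\langle v,\exp_x^{-1}y\rangle\le f(y)-f(x)\ \forall y\in C\}$; $f$ is subdifferentiable on $C$ if $\partial f(x)\ne\emptyset$ for all $x\in C$. Assumptions: (A2) $F(x,\cdot)$ is geodesically convex and subdifferentiable on $C$ for each $x\in C$. (A3) $F(\cdot,y)$ is upper semicontinuous on $C$ for each $y\in C$, i.e. $\limsup_{n}F(x_n,y)\le F(x,y)$ whenever $\{x_n\}\subset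 C$, $x\in C$, $x_n\to x$. It is known (from earlier literature) that under these hypotheses on $F$ the set $\mathrm{EP}(F,C)$ consists of exactly one point. *)

(* Defs.v *)
From HB Require Import structures.
From mathcomp Require Import all_boot all_order all_algebra.
From mathcomp Require Import all_classical all_reals all_analysis.
Import Order.TTheory GRing.Theory Num.Theory.
Import numFieldNormedType.Exports.

Set Implicit Arguments.
Unset Strict Implicit.
Unset Printing Implicit Defensive.

Local Open Scope classical_set_scope.
Local Open Scope ring_scope.

(* C^k on an open set U: all the directional derivatives are C^(k-1). *)
Fixpoint Ck (R : realType) (V W : normedModType R) (k : nat) (U : set V)
    (f : V -> W) : Prop :=
  match k with
  | 0%N => forall u, U u -> {for u, continuous f}
  | k'.+1 => (forall u, U u -> differentiable f u) /\
             (forall v : V, Ck k' U (fun u => 'D_v f u))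
  end.

Definition smooth_on (R : realType) (V W : normedModType R) (U : set V)
    (f : V -> W) : Prop := forall k, Ck k U f.

Record chart (R : realType) (T : topologicalType) (n : nat) := Chart {
  cdom : set T ;
  cmap : T -> 'rV[R]_n ;
  cinv : 'rV[R]_n -> T ;
  cdom_open : open cdom ;
  cimg_open : open (cmap @` cdom) ;
  cmapK : forall x, cdom x -> cinv (cmap x) = x ;
  cmap_continuous : forall x, cdom x -> {for x, continuous cmap} ;
  cinv_continuous : forall u, (cmap @` cdom) u -> {for u, continuous cinv}
}.

(* the image, in the coordinates of c, of the overlap of two charts *)
Definition overlap (R : realType) (T : topologicalType) (n : nat)
    (c c' : chart R T n) : set 'rV[R]_n :=
  cmap c @` (cdom c `&` cdom c').

Definition transition (R : realType) (T : topologicalType) (n : nat)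
    (c c' : chart R T n) : 'rV[R]_n -> 'rV[R]_n :=
  cmap c' \o cinv c.

(* Tensor calculus in an open set of R^n carrying the metric                 *)
(* G : u |-> (g_ij(u))_ij; tangent vectors are row vectors.                  *)
Section coordinates.
Variables (R : realType) (n : nat).
Implicit Types (G : 'rV[R]_n -> 'M[R]_n) (u v w : 'rV[R]_n) (i j k l : 'I_n).

Definition dotG (g : 'M[R]_n) v w : R := (v *m g *m w^T) 0 0.

Definition partial i (f : 'rV[R]_n -> R) u : R :=
  'D_(delta_mx 0 i : 'rV[R]_n) f u.

(* christoffel G k i j u is Gamma^k_ij(u) *)
Definition christoffel G k i j u : R :=
  2^-1 * \sum_l invmx (G u) k l *
    (partial i (fun w => G w j l) u + partial j (fun w => G w i l) u
     - partial l (fun w => G w i j) u).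

(* R(d_i, d_j) d_k = sum_l (riemann G l i j k) d_l, with the convention      *)
(* R(X, Y) = [nabla_X, nabla_Y] - nabla_[X, Y]                               *)
Definition riemann G l i j k u : R :=
  partial i (christoffel G l j k) u - partial j (christoffel G l i k) u
  + \sum_m (christoffel G m j k u * christoffel G l i m u
            - christoffel G m i k u * christoffel G l j m u).

Definition curvature G u v w : 'rV[R]_n :=
  \row_l \sum_i \sum_j \sum_k v 0 i * w 0 j * w 0 k * riemann G l i j k u.

(* K(v, w) = <R(v, w) w, v> / (|v|^2 |w|^2 - <v, w>^2) *)
Definition sectional G u v w : R :=
  dotG (G u) (curvature G u v w) v /
  (dotG (G u) v v * dotG (G u) w w - dotG (G u) v w ^+ 2).

End coordinates.

(* The atlas is indexed by the points: chart_at p is a chosen chart around p *)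
(* (every smooth structure has an atlas of this form), and metric p is the   *)
(* matrix of the Riemannian metric in the coordinates of chart_at p.         *)
Record riemannianManifold (R : realType) := RiemannianManifold {
  carrier :> topologicalType ;
  rdim : nat ;
  chart_at : carrier -> chart R carrier rdim ;
  metric : carrier -> 'rV[R]_rdim -> 'M[R]_rdim ;
  carrier_hausdorff : hausdorff_space carrier ;
  carrier_second_countable : @second_countable carrier ;
  chart_at_dom : forall p, cdom (chart_at p) p ;
  transition_smooth : forall p q,
    smooth_on (overlap (chart_at p) (chart_at q))
              (transition (chart_at p) (chart_at q)) ;
  metric_smooth : forall p i j,
    smooth_on (cmap (chart_at p) @` cdom (chart_at p))
              (fun u => metric p u i j) ;
  metric_sym : forall p u, (cmap (chart_at p) @` cdom (chart_at p)) u ->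
    (metric p u)^T = metric p u ;
  metric_pos : forall p u, (cmap (chart_at p) @` cdom (chart_at p)) u ->
    forall v, v != 0 -> 0 < dotG (metric p u) v v ;
  metric_transition : forall p q u, overlap (chart_at p) (chart_at q) u ->
    forall v w,
    let tau := transition (chart_at p) (chart_at q) in
    dotG (metric p u) v w =
    dotG (metric q (tau u)) ('D_v tau u) ('D_w tau u)
}.

Section riemannian.
Variables (R : realType) (M : riemannianManifold R).
Implicit Types (x y z p : M) (gam : R -> M).

Definition local_curve p gam : R -> 'rV[R]_(rdim M) :=
  cmap (chart_at p) \o gam.

(* T_x M is represented by the coordinates in chart_at x. *)
Definition tangent x : Type := 'rV[R]_(rdim M).

Definition tdot x (v w : tangent x) : R :=
  dotG (metric x (cmap (chart_at x) x)) v w.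

Definition velocity gam (t : R) : tangent (gam t) :=
  derive1 (local_curve (gam t) gam) t.

Definition speed gam (t : R) : R :=
  Num.sqrt (tdot (velocity gam t) (velocity gam t)).

Definition C1_at gam (t : R) : Prop :=
  {for t, continuous gam} /\
  forall p, cdom (chart_at p) (gam t) ->
    (\forall s \near t, derivable (local_curve p gam) s 1) /\
    {for t, continuous (derive1 (local_curve p gam))}.

Definition curve_length gam (a b : R) : \bar R :=
  (\int[lebesgue_measure]_(t in `[a, b]) (speed gam t)%:E)%E.

(* piecewise_C1 x y l: some piecewise C^1 curve from x to y, given as a      *)
(* concatenation of C^1 pieces, has length l                                 *)
Inductive piecewise_C1 : M -> M -> \bar R -> Prop :=
| Piecewise_nil x : piecewise_C1 x x 0%E
| Piecewise_cons gam (a b : R) y l :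
    a <= b -> (forall t, a <= t <= b -> C1_at gam t) ->
    piecewise_C1 (gam b) y l ->
    piecewise_C1 (gam a) y (curve_length gam a b + l)%E.

(* finite, hence unaffected by fine, as soon as M is connected *)
Definition rdist x y : R :=
  fine (ereal_inf [set l | piecewise_C1 x y l]).

(* A geodesic defined on the whole real line: in a complete manifold every   *)
(* geodesic segment or ray is the restriction of a unique such curve.        *)
Definition geodesic gam : Prop := forall t : R,
  {for t, continuous gam} /\
  forall p, cdom (chart_at p) (gam t) ->
    let c := local_curve p gam in
    [/\ derivable c t 1, derivable (derive1 c) t 1 &
      forall k, derive1 (derive1 c) t 0 k +
        \sum_i \sum_j christoffel (metric p) k i j (c t)
                      * derive1 c t 0 i * derive1 c t 0 j = 0].

(* geodesic completeness, i.e. exp_x is defined on all of T_x M *)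
Definition complete_manifold : Prop :=
  forall x (v : tangent x), exists gam,
    [/\ geodesic gam, gam 0 = x & velocity gam 0 = v].

Definition simply_connected : Prop :=
  (forall x y, exists gam, [/\ {within `[0, 1], continuous gam},
                               gam 0 = x & gam 1 = y]) /\
  (forall gam, {within `[0, 1], continuous gam} -> gam 0 = gam 1 ->
     exists H : R * R -> M,
       [/\ {within `[0, 1] `*` `[0, 1], continuous H},
           (forall t, 0 <= t <= 1 -> H (0, t) = gam t),
           (forall t, 0 <= t <= 1 -> H (1, t) = gam 0) &
           (forall s, 0 <= s <= 1 -> H (s, 0) = gam 0 /\ H (s, 1) = gam 0)]).

Definition nonpositive_curvature : Prop :=
  forall p u, (cmap (chart_at p) @` cdom (chart_at p)) u ->
  forall v w : 'rV[R]_(rdim M), row_free (col_mx v w) ->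
    sectional (metric p) u v w <= 0.

End riemannian.

Arguments tangent {R M} x.
Arguments tdot {R M} x v w.

Record hadamardManifold (R : realType) := HadamardManifold {
  hmanifold :> riemannianManifold R ;
  hcomplete : complete_manifold hmanifold ;
  hsimply_connected : simply_connected hmanifold ;
  hnonpositive : nonpositive_curvature hmanifold
}.

Section hadamard.
Variables (R : realType) (M : hadamardManifold R).
Implicit Types (x y z : M) (C : set M) (f : M -> R) (F : M -> M -> R).

(* exp_x v = gam 1, where gam is the geodesic with gam 0 = x, gam' 0 = v *)
Definition expmap x (v : tangent x) : M :=
  xget x [set y | exists gam : R -> M,
    [/\ geodesic gam, gam 0 = x, velocity gam 0 = v & gam 1 = y]].

Arguments expmap x v : clear implicits.

Definition expmap_inv x y : tangent x :=
  xget (0 : 'rV[R]_(rdim M)) [set v | expmap x v = y].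

Arguments expmap_inv x y : clear implicits.

Definition geodesically_convex C : Prop :=
  forall gam : R -> M, geodesic gam -> C (gam 0) -> C (gam 1) ->
  forall t, 0 <= t <= 1 -> C (gam t).

Definition geodesically_convex_fun C f : Prop :=
  forall gam : R -> M, geodesic gam ->
  (forall t, 0 <= t <= 1 -> C (gam t)) ->
  @convex_function R R^o `[0, 1] (f \o gam).

Definition subdifferential C f x : set (tangent x) :=
  [set v | forall y, C y -> tdot x v (expmap_inv x y) <= f y - f x].

Arguments subdifferential C f x : clear implicits.

Definition subdifferentiable C f : Prop :=
  forall x, C x -> subdifferential C f x !=set0.

Definition EP F C : set M :=
  [set x | C x /\ forall y, C y -> 0 <= F x y].

Definition strongly_pseudomonotone C F (beta : R) : Prop :=
  forall x y, C x -> C y -> 0 <= F x y -> F y x <= - (beta * rdist x y ^+ 2).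

Definition usc_on C f : Prop :=
  forall (u : nat -> M) x, (forall n, C (u n)) -> C x -> u @ \oo --> x ->
  (limn_esup (fun n => (f (u n))%:E) <= (f x)%:E)%E.

(* Only the restriction of gam to [0, +oo[ matters. *)
Definition is_unit_ray z x (gam : R -> M) : Prop :=
  [/\ geodesic gam, forall t, speed gam t = 1, gam 0 = z &
      exists2 t, 0 <= t & gam t = x].

(* gamma_{z, x}; on a Hadamard manifold the ray exists and is unique on       *)
(* [0, +oo[ for z != x, and the default value of xget is not used             *)
Definition unit_ray z x : R -> M :=
  xget (fun=> z) [set gam | is_unit_ray z x gam].

Definition busemann (gam : R -> M) y : R :=
  lim ((rdist y (gam t) - t) @[t --> +oo]).

(* d(z, x) b_{gamma_{z, x}}(y), read as 0 when z = x *)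
Definition dist_busemann z x y : R :=
  if x == z then 0 else rdist z x * busemann (unit_ray z x) y.

Definition argmin_on C f : set M :=
  [set x | C x /\ forall y, C y -> f x <= f y].

End hadamard.

Arguments expmap {R M} x v.
Arguments expmap_inv {R M} x y.
Arguments subdifferential {R M} C f x.

(* Main.v *)
(* Write p for the solution. Since F(p, y_n) >= 0, strong pseudomonotonicity and
   step (1) at p give
     beta lam_n d(y_n, p)^2 <= d(y_n, x_n) b(p) <= d(y_n, x_n) d(y_n, p),
   because a Busemann function is 1-Lipschitz and b(y_n) <= 0; dividing by
   d(y_n, p) and using the triangle inequality yields the bound.

   Of the Busemann function only b(p) <= d(p, y_n) matters, and for this it is
   enough that the length of a unit-speed geodesic bounds the distance from above.
   The work lies in showing that the infimum of lengths is a pseudometric.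
   Symmetry needs the change of variables t |-> - t, hence the continuity of the
   speed, which is measured in a chart varying with t. The triangle inequality
   needs finiteness of the infimum ([fine] maps +oo to 0): coordinate segments
   make the classes of points joined by piecewise C^1 curves clopen, and M is path
   connected. *)
Require Import Defs.
From mathcomp Require Import all_boot all_order all_algebra.
From mathcomp Require Import all_classical all_reals all_analysis.
From mathcomp Require Import lra.
Import Order.TTheory GRing.Theory Num.Theory.
Import numFieldNormedType.Exports.
Local Open Scope classical_set_scope.
Local Open Scope ring_scope.

Set Implicit Arguments.
Unset Strict Implicit.

(** * Chain rule, limits of the metric pairing, and chart overlaps *)

Lemma derive1_chain (R : realType) (V W : normedModType R) (c : R -> V)
    (f : V -> W) (s : R) :
  derivable c s 1 -> differentiable f (c s) ->
  is_derive s 1 (f \o c) ('D_(derive1 c s) f (c s)).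
Proof.
move=> /derivable1_diffP dc df.
have dfc : differentiable (f \o c) s by apply: differentiable_comp.
apply: DeriveDef; first exact/derivable1_diffP.
by rewrite -derive1E derive1E'// diff_comp//= derive1E'// deriveE.
Qed.

Lemma cvg_dotG (R : realType) (n : nat) (T : Type) (F : set_system T)
    (FF : Filter F) (g : T -> 'M[R]_n) (v w : T -> 'rV[R]_n)
    (g0 : 'M[R]_n) (v0 w0 : 'rV[R]_n) :
  (forall i j, g x i j @[x --> F] --> g0 i j) ->
  v @ F --> v0 -> w @ F --> w0 ->
  dotG (g x) (v x) (w x) @[x --> F] --> dotG g0 v0 w0.
Proof.
move=> gg0 vv0 ww0.
have coord (u : T -> 'rV[R]_n) (u0 : 'rV[R]_n) i :
      u @ F --> u0 -> u x 0 i @[x --> F] --> u0 0 i.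
  by move=> uu0; have /continuous_cvg := @coord_continuous R 1 n 0 i u0; exact.
have dotE (h : 'M[R]_n) (a b : 'rV[R]_n) :
    dotG h a b = \sum_j (\sum_i a 0 i * h i j) * b 0 j.
  by rewrite /dotG mxE; apply: eq_bigr => j _; rewrite !mxE.
rewrite dotE; under eq_fun do rewrite dotE.
apply: cvg_big => [|j _]; first exact: add_continuous.
apply: cvgM; last exact: coord.
apply: cvg_big => [|i _]; first exact: add_continuous.
by apply: cvgM; [exact: coord|exact: gg0].
Qed.

(** Near a point of the overlap, membership amounts to lying in the open image of [c] and being sent
    by [cinv c], which is continuous there, into the open domain of [c']. *)
Lemma overlap_open (R : realType) (T : topologicalType) (n : nat)
    (c c' : chart R T n) : open (overlap c c').
Proof.
rewrite openE => u [z [cz c'z] <-].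
have imz : (cmap c @` cdom c) (cmap c z) by exists z.
have nearim : \forall v \near cmap c z, (cmap c @` cdom c) v.
  by apply: open_nbhs_nbhs; split=> //; exact: cimg_open.
have neardom : \forall v \near cmap c z, cdom c' (cinv c v).
  apply: (cinv_continuous imz).
  by rewrite cmapK//; apply: open_nbhs_nbhs; split=> //; exact: cdom_open.
rewrite /interior; near=> v.
have [w cw vw] : (cmap c @` cdom c) v by near: v.
exists w => //; split=> //; rewrite -(cmapK cw) vw.
by near: v.
Unshelve. all: by end_near. Qed.

(** * Velocity and speed of a curve read in a fixed chart *)

Section curves.
Variables (R : realType) (M : riemannianManifold R).
Implicit Types (x y z p q : M) (gam : R -> M) (a b s t : R).

Lemma near_cdom p gam t : {for t, continuous gam} ->
  cdom (chart_at p) (gam t) -> \forall s \near t, cdom (chart_at p) (gam s).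
Proof.
move=> gt pt; apply: gt; apply: open_nbhs_nbhs; split=> //.
exact: cdom_open.
Qed.

Lemma local_curve_transition p q gam s :
  {for s, continuous gam} ->
  cdom (chart_at p) (gam s) -> cdom (chart_at q) (gam s) ->
  derivable (local_curve p gam) s 1 ->
  is_derive s 1 (local_curve q gam)
    ('D_(derive1 (local_curve p gam) s)
       (transition (chart_at p) (chart_at q)) (local_curve p gam s)).
Proof.
move=> gs ps qs dp.
have ov : overlap (chart_at p) (chart_at q) (local_curve p gam s).
  by exists (gam s).
have [dtau _] := @transition_smooth R M p q 1%N.
apply: near_eq_is_derive; last exact: derive1_chain dp (dtau _ ov).
near=> r; rewrite /local_curve/transition/= cmapK//.
by near: r; exact: near_cdom.
Unshelve. all: by end_near. Qed.

(** [speed] measures each velocity in the chart chosen at the current point. Invariance of the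
    metric under transitions allows one fixed chart [p] instead, in which continuity in time can be
    proved. *)
Lemma speedE p gam s :
  {for s, continuous gam} -> cdom (chart_at p) (gam s) ->
  derivable (local_curve p gam) s 1 ->
  speed gam s = Num.sqrt (dotG (metric p (local_curve p gam s))
    (derive1 (local_curve p gam) s) (derive1 (local_curve p gam) s)).
Proof.
move=> gs ps dp; rewrite /speed /tdot /velocity; apply: (congr1 Num.sqrt).
have qs : cdom (chart_at (gam s)) (gam s) by exact: chart_at_dom.
have ov : overlap (chart_at p) (chart_at (gam s)) (local_curve p gam s).
  by exists (gam s).
have /@derive_val := local_curve_transition gs ps qs dp.
rewrite -derive1E => ->.
by rewrite (metric_transition ov)/= /transition/= /local_curve/= cmapK.
Qed.

(* C1_at only asks for continuity at t itself; near t it follows from the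
   differentiability of the coordinates. *)
Lemma C1_at_near_continuous gam t : C1_at gam t ->
  \forall s \near t, {for s, continuous gam}.
Proof.
move=> [gt C1]; set p := gam t.
have pt : cdom (chart_at p) (gam t) by exact: chart_at_dom.
have [dp _] := C1 p pt.
have domt := near_cdom gt pt.
(* Recovering [gam] near [s] as [cinv] of its coordinates requires it to stay in the chart domain on
   a whole neighbourhood of [s]. *)
have domtt : \forall s \near t, \forall r \near s, cdom (chart_at p) (gam r).
  exact/near_join.
near=> s.
have domss : \forall r \near s, cdom (chart_at p) (gam r) by near: s.
have cs : {for s, continuous (local_curve p gam)}.
  apply: differentiable_continuous; apply/derivable1_diffP.
  by near: s.
have E : \forall r \near s, cinv (chart_at p) (local_curve p gam r) = gam r.
  by apply: filterS domss => r; exact: cmapK.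
have sdom : cdom (chart_at p) (gam s) by exact: nbhs_singleton domss.
rewrite /prop_for/continuous_at -(nbhs_singleton E).
apply: cvg_trans; first exact: (near_eq_cvg E).
apply: continuous_cvg cs.
by apply: cinv_continuous; exists (gam s).
Unshelve. all: by end_near. Qed.

Lemma speed_continuous gam t :
  C1_at gam t -> {for t, continuous (speed gam)}.
Proof.
move=> C1t; have gcont := C1_at_near_continuous C1t.
have [gt C1] := C1t; set p := gam t.
have pt : cdom (chart_at p) (gam t) by exact: chart_at_dom.
have [dp cdp] := C1 p pt.
rewrite /prop_for/continuous_at.
rewrite (speedE gt pt (nbhs_singleton dp)).
have E : \forall s \near t, Num.sqrt (dotG (metric p (local_curve p gam s))
    (derive1 (local_curve p gam) s) (derive1 (local_curve p gam) s)) =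
    speed gam s.
  near=> s; apply/esym/speedE.
  - by near: s; exact: gcont.
  - by near: s; exact: near_cdom.
  - by near: s; exact: dp.
apply: cvg_trans; first exact: (near_eq_cvg E).
apply: continuous_cvg; first exact: sqrt_continuous.
have ct : {for t, continuous (local_curve p gam)}.
  apply: differentiable_continuous; apply/derivable1_diffP.
  exact: nbhs_singleton dp.
apply: cvg_dotG => // i j.
have mt : {for local_curve p gam t, continuous (fun u => metric p u i j)}.
  by apply: (@metric_smooth R M p i j 0%N); exists (gam t).
exact: (@continuous_comp _ _ _ (local_curve p gam)
  (fun u => metric p u i j) t ct mt).
Unshelve. all: by end_near. Qed.

(** * Time reversal *)

Lemma is_derive_oppr (V : normedModType R) (f : R -> V) t :
  derivable f (- t) 1 -> is_derive t 1 (f \o -%R) (- derive1 f (- t)).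
Proof.
move=> df; have df' : differentiable f (- t) by exact/derivable1_diffP.
have dN : derivable (-%R : R -> R) t 1 by [].
have := derive1_chain dN df'.
have -> : derive1 (-%R : R -> R) t = - 1.
  by rewrite derive1E; exact: derive_val.
by rewrite deriveE// linearN derive1E'.
Qed.

Lemma near_oppr t (P : R -> Prop) : nbhs (- t) P -> nbhs t (-%R @^-1` P).
Proof. exact: (@opp_continuous R t). Qed.

Lemma continuous_oppr (T : topologicalType) (f : R -> T) t :
  {for - t, continuous f} -> {for t, continuous (f \o -%R)}.
Proof. by move=> ft A /ft; exact: near_oppr. Qed.

Lemma C1_at_oppr gam t : C1_at gam (- t) -> C1_at (gam \o -%R) t.
Proof.
move=> [gt C1]; split; first exact: continuous_oppr.
move=> p pt; have [dp cdp] := C1 p pt.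
have E : nbhs t (-%R @^-1` [set s | derivable (local_curve p gam) s 1]).
  exact: near_oppr.
have dN s : (-%R @^-1` [set s | derivable (local_curve p gam) s 1]) s ->
    is_derive s 1 (local_curve p (gam \o -%R))
      (- (derive1 (local_curve p gam) \o -%R) s).
  exact: is_derive_oppr.
split; first by apply: filterS E => s /dN[].
have {}E : \forall s \near t, - (derive1 (local_curve p gam) \o -%R) s =
    derive1 (local_curve p (gam \o -%R)) s.
  by apply: filterS E => s /dN[_ <-]; rewrite derive1E.
rewrite /prop_for/continuous_at -(nbhs_singleton E).
apply: cvg_trans; first exact: (near_eq_cvg E).
apply: cvgN; exact: continuous_oppr.
Qed.

(** Reversal negates the velocity, and the squared norm is even. *)
Lemma speed_oppr gam t : C1_at gam t -> speed (gam \o -%R) (- t) = speed gam t.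
Proof.
move=> [gt C1]; rewrite /speed /tdot /velocity /comp opprK.
apply: (congr1 Num.sqrt).
have [/nbhs_singleton dp _] := C1 (gam t) (chart_at_dom (gam t)).
rewrite -[in derivable _ _ _](opprK t) in dp.
have [_] := is_derive_oppr dp.
rewrite -derive1E opprK => ->.
by rewrite /dotG linearN/= !(mulNmx, mulmxN) opprK.
Qed.

(** * Lengths of piecewise C^1 curves and symmetry of the distance *)

Definition C1_on gam a b : Prop := forall t, a <= t <= b -> C1_at gam t.

Lemma C1_on_speed_continuous gam a b : C1_on gam a b ->
  {within `[a, b], continuous (speed gam)}.
Proof.
move=> C1; apply: continuous_in_subspaceT => t; rewrite inE/= in_itv/= => tab.
exact/speed_continuous/C1.
Qed.

Lemma C1_on_oppr gam a b : C1_on gam a b -> C1_on (gam \o -%R) (- b) (- a).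
Proof. by move=> C1 t tab; apply/C1_at_oppr/C1; lra. Qed.

Lemma curve_length_ge0 gam a b : (0 <= curve_length gam a b)%E.
Proof. by apply: integral_ge0 => t _; rewrite lee_fin sqrtr_ge0. Qed.

Lemma curve_length_fin_num gam a b : C1_on gam a b ->
  curve_length gam a b \is a fin_num.
Proof.
move=> C1; apply: integrable_fin_num => //.
apply: continuous_compact_integrable; first exact: segment_compact.
exact: C1_on_speed_continuous.
Qed.

Lemma curve_length_oppr gam a b : a <= b -> C1_on gam a b ->
  curve_length (gam \o -%R) (- b) (- a) = curve_length gam a b.
Proof.
move=> ab C1; have cG := C1_on_speed_continuous (C1_on_oppr C1).
rewrite /curve_length (integration_by_substitution_oppr ab cG).
apply: eq_integral => t; rewrite inE/= in_itv/= => tab.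
exact: (congr1 EFin (speed_oppr (C1 t tab))).
Qed.

Lemma piecewise_C1_ge0 x y l : piecewise_C1 x y l -> (0 <= l)%E.
Proof.
by elim=> // *; rewrite adde_ge0// curve_length_ge0.
Qed.

Lemma piecewise_C1_fin_num x y l : piecewise_C1 x y l -> l \is a fin_num.
Proof.
by elim=> // gam a b z l' ab C1 _ ?; rewrite fin_numD curve_length_fin_num.
Qed.

Lemma piecewise_C1_single gam a b : a <= b -> C1_on gam a b ->
  piecewise_C1 (gam a) (gam b) (curve_length gam a b).
Proof.
move=> ab C1; rewrite -[curve_length _ _ _]adde0.
by apply: Piecewise_cons => //; exact: Piecewise_nil.
Qed.

Lemma piecewise_C1_trans x y z l m : piecewise_C1 x y l ->
  piecewise_C1 y z m -> piecewise_C1 x z (l + m)%E.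
Proof.
elim=> [w|gam a b w k ab C1 _ ih] zm; first by rewrite add0e.
by rewrite -addeA; apply: Piecewise_cons => //; exact: ih.
Qed.

Lemma piecewise_C1_sym x y l : piecewise_C1 x y l -> piecewise_C1 y x l.
Proof.
elim=> [w|gam a b w k ab C1 _ ih]; first exact: Piecewise_nil.
(* The reversed first piece comes after the reversed remainder, hence the swap of the two
   lengths. *)
rewrite addeC; apply: piecewise_C1_trans ih _.
rewrite -curve_length_oppr//.
have := piecewise_C1_single _ (C1_on_oppr C1).
by rewrite /= !opprK; apply; rewrite lerN2.
Qed.

Lemma rdist_sym x y : rdist x y = rdist y x.
Proof.
congr (fine (ereal_inf _)); apply/seteqP.
by split=> l; exact: piecewise_C1_sym.
Qed.

Lemma ereal_inf_piecewise_C1_ge0 x y :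
  (0 <= ereal_inf [set l | piecewise_C1 x y l])%E.
Proof. by apply: le_ereal_inf_tmp => l; exact: piecewise_C1_ge0. Qed.

Lemma rdist_ge0 x y : 0 <= rdist x y.
Proof. exact/fine_ge0/ereal_inf_piecewise_C1_ge0. Qed.

(** The infimum lies between 0 and the real number [l], so it is finite and [fine] keeps its
    value. *)
Lemma rdist_le x y l : piecewise_C1 x y l%:E -> rdist x y <= l.
Proof.
move=> xyl; have := ereal_inf_lbound xyl.
by rewrite /rdist; case: ereal_inf (ereal_inf_piecewise_C1_ge0 x y).
Qed.

Lemma rdist_xx x : rdist x x = 0.
Proof.
by apply/le_anti/andP; split; [apply/rdist_le/Piecewise_nil|exact: rdist_ge0].
Qed.

(** * Coordinate segments and reachability by piecewise C^1 curves *)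

Lemma is_derive_line (V : normedModType R) (u w : V) s :
  is_derive s 1 (fun r : R => u + r *: w) w.
Proof.
have [df dE] : is_diff s (cst u + *:%R ^~ w) (0 + *:%R ^~ w : R -> V).
  exact: is_diffD.
apply: DeriveDef; first exact/derivable1_diffP.
by rewrite deriveE// dE add0r scale1r.
Qed.

(** In a chart [q] the segment reads as the transition map along a line. As the direction [w] is
    constant, its derivative is the single directional derivative ['D_w tau] along that line, which
    is continuous because [tau] is C^1. *)
Lemma C1_at_segment p (u w : 'rV[R]_(rdim M)) t :
  (cmap (chart_at p) @` cdom (chart_at p)) (u + t *: w) ->
  C1_at (fun s => cinv (chart_at p) (u + s *: w)) t.
Proof.
set line : R -> 'rV[R]_(rdim M) := fun s => u + s *: w.
set gam := fun s => _; move=> imt.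
have dline s : is_derive s 1 line w := is_derive_line u w s.
have dline1 s : derive1 line s = w by rewrite derive1E; exact: derive_val.
have cline s : {for s, continuous line}.
  apply: differentiable_continuous; apply/derivable1_diffP.
  by have [] := dline s.
have gt : {for t, continuous gam}.
  exact: (@continuous_comp _ _ _ line (cinv (chart_at p)) t (cline t)
    (cinv_continuous imt)).
split=> [|q qt]; first exact: gt.
have [z pz zt] := imt.
have ovt : overlap (chart_at p) (chart_at q) (line t).
  by exists z => //; split=> //; move: qt; rewrite /gam -zt cmapK.
set tau := transition (chart_at p) (chart_at q).
have ovnear : \forall s \near t, overlap (chart_at p) (chart_at q) (line s).
  apply: cline; apply: open_nbhs_nbhs; split=> //; exact: overlap_open.
have dtau s : overlap (chart_at p) (chart_at q) (line s) ->
    is_derive s 1 (local_curve q gam) ('D_w tau (line s)).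
  move=> ovs; have [dtau _] := @transition_smooth R M p q 1%N.
  have [dl _] := dline s; rewrite -[X in 'D_X _ _](dline1 s).
  exact: (derive1_chain dl (dtau _ ovs)).
split; first by apply: filterS ovnear => s /dtau[].
rewrite /prop_for/continuous_at.
have E : \forall s \near t, 'D_w tau (line s) = derive1 (local_curve q gam) s.
  by apply: filterS ovnear => s /dtau[_ <-]; rewrite derive1E.
rewrite -(nbhs_singleton E).
apply: cvg_trans; first exact: (near_eq_cvg E).
have [_ ctau] := @transition_smooth R M p q 1%N.
exact: (@continuous_comp _ _ _ line (fun u => 'D_w tau u) t (cline t)
  (ctau w _ ovt)).
Qed.

(** The image of the chart contains a ball around the coordinates of [x], and with each of its
    points the ball contains the segment from the centre. *)
Lemma piecewise_C1_near x : \forall y \near x, exists l, piecewise_C1 x y l.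
Proof.
set c := chart_at x; set u := cmap c x.
have cx : cdom c x by exact: chart_at_dom.
have : nbhs u (cmap c @` cdom c).
  by apply: open_nbhs_nbhs; split; [exact: cimg_open|exists x].
move=> /nbhs_ballP[e /= e0 eim].
have cnear : \forall y \near x, ball u e (cmap c y).
  by apply: (cmap_continuous cx); exact: nbhsx_ballx.
have dnear : \forall y \near x, cdom c y.
  by apply: open_nbhs_nbhs; split=> //; exact: cdom_open.
near=> y.
have cy : cdom c y by near: y.
have uy : ball u e (cmap c y) by near: y.
rewrite -ball_normE/= in uy.
set gam := fun s => cinv c (u + s *: (cmap c y - u)).
have g0 : gam 0 = x by rewrite /gam scale0r addr0 cmapK.
have g1 : gam 1 = y by rewrite /gam scale1r addrC subrK cmapK.
have C1 : C1_on gam 0 1; last first.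
  exists (curve_length gam 0 1).
  rewrite -[X in piecewise_C1 X]g0 -[X in piecewise_C1 _ X]g1.
  exact: piecewise_C1_single C1.
move=> t /andP[t0 t1].
apply: C1_at_segment; apply: eim; rewrite -ball_normE/=.
rewrite opprD addrA subrr add0r normrN normrZ ger0_norm// distrC.
by apply: le_lt_trans uy; rewrite ler_piMl.
Unshelve. all: by end_near. Qed.

Lemma reachable_open x : open [set y | exists l, piecewise_C1 x y l].
Proof.
rewrite openE => y [l xy]; apply: filterS (piecewise_C1_near y) => z [m yz].
by exists (l + m)%E; exact: piecewise_C1_trans yz.
Qed.

(** If an unreachable [y] had a reachable [z] nearby, reversing the curve from [y] to [z] would
    reach [y]. *)
Lemma reachable_closed x : closed [set y | exists l, piecewise_C1 x y l].
Proof.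
rewrite -openC openE => y nxy; apply: filterS (piecewise_C1_near y) => z [m yz].
move=> [l xz]; apply: nxy; exists (l + m)%E.
exact: piecewise_C1_trans (piecewise_C1_sym yz).
Qed.

(** The path is merely continuous and only supplies a connected set, in which the points reachable
    from [x] form a nonempty clopen part. *)
Lemma path_reachable x y gam : {within `[0, 1], continuous gam} ->
  gam 0 = x -> gam 1 = y -> exists l, piecewise_C1 x y l.
Proof.
move=> cg g0 g1; set A := [set z | exists l, piecewise_C1 x z l].
have conn : connected (gam @` `[0, 1]).
  exact: connected_continuous_connected (@segment_connected R 0 1) cg.
have E : gam @` `[0, 1] `&` A = gam @` `[0, 1].
  apply: conn.
  - exists x; split; last by exists 0%E; exact: Piecewise_nil.
    by exists 0 => //=; rewrite in_itv/= lexx ler01.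
  - by exists A => //; exact: reachable_open.
  - by exists A => //; exact: reachable_closed.
have : (gam @` `[0, 1]) y by exists 1 => //=; rewrite in_itv/= lexx ler01.
by rewrite -E => -[].
Qed.

Lemma rdist_triangle : simply_connected M ->
  forall x y z, rdist x z <= rdist x y + rdist y z.
Proof.
move=> [path _] x y z; apply/ler_addgt0Pr => e e0.
(* Finiteness of the infimum yields curves within [e / 2] of it; concatenating two of them loses
   [e]. *)
have approx p q : exists2 l, piecewise_C1 p q l%:E & l <= rdist p q + e / 2.
  have [gam [cg g0 g1]] := path p q.
  have [m pqm] := path_reachable cg g0 g1.
  have infty : (ereal_inf [set l | piecewise_C1 p q l] < +oo)%E.
    apply: le_lt_trans (ereal_inf_lbound pqm) _.
    by rewrite ltey_eq (piecewise_C1_fin_num pqm).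
  have fin : ereal_inf [set l | piecewise_C1 p q l] \is a fin_num.
    by rewrite ge0_fin_numE// ereal_inf_piecewise_C1_ge0.
  have [l pql] := lb_ereal_inf_adherent (divr_gt0 e0 (ltr0n R 2)) fin.
  have lfin := piecewise_C1_fin_num pql.
  rewrite -(fineK fin) -(fineK lfin) -EFinD lte_fin => /ltW ltl.
  by exists (fine l) => //; rewrite fineK.
have [l xyl lle] := approx x y; have [m yzm mle] := approx y z.
have := rdist_le (piecewise_C1_trans xyl yzm); lra.
Qed.

(** * Geodesics and the Busemann bound *)

Lemma geodesic_C1_at gam t : geodesic gam -> C1_at gam t.
Proof.
move=> geo; split=> [|p pt]; first by have [] := geo t.
split.
  have [gt _] := geo t; apply: filterS (near_cdom gt pt) => s ps.
  by have [_ /(_ p ps)[]] := geo s.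
have [_ /(_ p pt)[_ dd _]] := geo t.
by apply: differentiable_continuous; apply/derivable1_diffP.
Qed.

Lemma rdist_unit_speed gam t : geodesic gam -> (forall s, speed gam s = 1) ->
  0 <= t -> rdist (gam 0) (gam t) <= t.
Proof.
move=> geo sp1 t0; apply: rdist_le.
have -> : t%:E = curve_length gam 0 t.
  rewrite /curve_length; under eq_integral do rewrite sp1.
  rewrite integral_cst//= mul1e lebesgue_measure_itv/= lte_fin.
  (* The measure of the interval is given by cases, and [t = 0] falls in the degenerate one. *)
  by case: ltgtP t0 => [||<-]// _ _; rewrite oppr0 adde0.
by apply: piecewise_C1_single => // s _; exact: geodesic_C1_at.
Qed.

End curves.

(* No existence of the limit is needed: a divergent [lim] is the junk value 0,
   and the default (constant) value of [unit_ray] satisfies the same bound on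
   d(z, gamma t) as a unit-speed ray. *)
Lemma busemann_unit_ray_le (R : realType) (M : hadamardManifold R)
    (z x p : M) : busemann (unit_ray z x) p <= rdist p z.
Proof.
have ray t : 0 <= t -> rdist z (unit_ray z x t) <= t.
  move=> t0; rewrite /unit_ray; case: xgetP => [gam _ [geo sp1 <- _]|_].
    exact: rdist_unit_speed.
  by rewrite rdist_xx.
rewrite /busemann; have [cvl|dvl] := pselect (cvg
    ((rdist p (unit_ray z x t) - t) @[t --> +oo])); last first.
  by rewrite dvgP// rdist_ge0.
apply: limr_le => //; near=> t.
have t0 : 0 <= t by near: t; exact: nbhs_pinfty_ge.
(* d(p, gamma(t)) - t <= d(p, z) + (d(z, gamma(t)) - t) <= d(p, z). *)
have := rdist_triangle (hsimply_connected M) p z (unit_ray z x t).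
by have := ray t t0; lra.
Unshelve. all: by end_near. Qed.

Theorem theorem14 (R : realType) (M : hadamardManifold R)
    (C : set M) (beta : R) (F : M -> M -> R)
    (C_nonempty : C !=set0) (C_closed : closed C)
    (C_convex : geodesically_convex C)
    (beta_gt0 : 0 < beta)
    (F_pseudo : strongly_pseudomonotone C F beta)
    (F_diag : forall x, C x -> F x x = 0)
    (A2 : forall x, C x ->
       geodesically_convex_fun C (F x) /\ subdifferentiable C (F x))
    (A3 : forall y, C y -> usc_on C (fun x => F x y))
    (xstar : M) (xstar_EP : EP F C xstar)
    (lambda : R) (lambda_gt0 : 0 < lambda)
    (lam : nat -> R) (lam_ge : forall n, lambda <= lam n)
    (x y : nat -> M) (x_in : forall n, C (x n)) (y_in : forall n, C (y n))
    (step1 : forall n z, C z ->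
       0 <= lam n * F (y n) z + dist_busemann (y n) (x n) z)
    (step2 : forall n,
       argmin_on C (fun z => F (y n) z + (2 * lam n)^-1 * rdist (x n) z ^+ 2)
         (x n.+1)) :
  forall n, rdist (x n) xstar <= (1 + (beta * lam n)^-1) * rdist (y n) (x n).
Proof.
move=> n; have [Cs EPs] := xstar_EP.
have lam0 : 0 < lam n by exact: lt_le_trans (lam_ge n).
have tri := rdist_triangle (hsimply_connected M) (x n) (y n) xstar.
have upper := F_pseudo _ _ Cs (y_in n) (EPs _ (y_in n)).
rewrite (rdist_sym xstar) in upper.
rewrite (rdist_sym (x n) (y n)) in tri.
have lower : 0 <= lam n * F (y n) xstar + rdist (y n) (x n) * rdist (y n) xstar.
  apply: le_trans (step1 n _ Cs) _; rewrite lerD2l /dist_busemann.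
  (* When [x n = y n] the Busemann term is 0 by convention, still at most the product of
     distances. *)
  case: eqP => _; first by rewrite mulr_ge0// rdist_ge0.
  by rewrite ler_wpM2l ?rdist_ge0// (rdist_sym (y n) xstar) busemann_unit_ray_le.
(* The summand 1 of the constant comes from the triangle inequality through [y n]. *)
suff : rdist (y n) xstar <= (beta * lam n)^-1 * rdist (y n) (x n) by lra.
have bl0 : 0 < beta * lam n by exact: mulr_gt0.
rewrite mulrC ler_pdivlMr//.
(* The bound is trivial if [y n] is at distance 0 from [xstar]; otherwise multiplying by this
   distance reduces it to [lower] combined with [lam n] times [upper]. *)
have := rdist_ge0 (y n) xstar; rewrite le_eqVlt => /predU1P[<-|d0].
  by rewrite mul0r rdist_ge0.
rewrite -(ler_pM2r d0); nra.
Qed.
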